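(* Let $\mathcal{X}$ and $\mathcal{Z}$ be subsets of a common normed space (norm $\|\cdot\|$), let $\mathbf{x}\in\mathcal{X}$, and let $q(\cdot\mid\cdot)$ be an $\varepsilon$-LDP mechanism from $\mathcal{X}$ to $\mathcal{Z}$. Let $p$ be a reference distribution on $\mathcal{Z}$ such that $|\ln(q(\mathbf{z}\mid\mathbf{x})/p(\mathbf{z}))|\le\varepsilon$ for all $\mathbf{x}\in\mathcal{X}$, $\mathbf{z}\in\mathcal{Z}$. Let $c\ge 0$ be a constant and let the number of candidates be $N=2^{(\log e+4c)\varepsilon}$. Then, with probability at least $1-2\alpha$ over the draw of the candidates $\mathbf{z}_1,\dots,\mathbf{z}_N$, \[ \Big|\mathbb{E}_{q^{\mathrm{mrc}}}\big[\|\mathbf{z}-\mathbf{x}\|^2\big]-\mathbb{E}_{q}\big[\|\mathbf{z}-\mathbf{x}\|^2\big]\Big|\le\frac{2\alpha\sqrt{\mathbb{E}_{q}[\|\mathbf{z}-\mathbf{x}\|^4]}}{1-\alpha}, \qquad \alpha=\sqrt{2^{-c\varepsilon}+2^{-c^2/\log e+1}}, \] where $\mathbb{E}_q$ is over $\mathbf{z}\sim q(\cdot\mid\mathbf{x})$ and $\mathbb{E}_{q^{\mathrm{mrc}}}$ is over $\mathbf{z}\sim q^{\mathrm{mrc}}(\cdot\mid\mathbf{x})$ for the given candidates.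
   Context: $\log$ denotes the base-2 logarithm and $\ln$ the natural logarithm. A mechanism $q$ maps $\mathbf{x}\in\mathcal{X}$ to a random $\mathbf{z}\in\mathcal{Z}$ with conditional density (or probability mass function) $q(\mathbf{z}\mid\mathbf{x})$; it is $\varepsilon$-LDP if $q(\mathbf{z}\mid\mathbf{x})\le e^{\varepsilon}q(\mathbf{z}\mid\mathbf{x}')$ for all $\mathbf{x},\mathbf{x}'\in\mathcal{X}$, $\mathbf{z}\in\mathcal{Z}$. Minimal Random Coding (MRC): given $q$, a reference distribution $p$ on $\mathcal{Z}$ (density w.r.t. the same base measure) and an integer $N\ge1$, draw candidates $\mathbf{z}_1,\dots,\mathbf{z}_N$ i.i.d. from $p$ (shared randomness, independent of $\mathbf{x}$), set weights $w(k)=q(\mathbf{z}_k\mid\mathbf{x})/p(\mathbf{z}_k)$ and $\pi^{\mathrm{mrc}}_{\mathbf{x}}(k)=w(k)/\sum_{k'=1}^N w(k')$ for $k\in[N]$. The user sends $K\sim\pi^{\mathrm{mrc}}_{\mathbf{x}}$, and $q^{\mathrm{mrc}}(\cdot\mid\mathbf{x})=\sum_{k}\pi^{\mathrm{mrc}}_{\mathbf{x}}(k)\,\delta_{\mathbf{z}_k}$ is the distribution of $\mathbf{z}_K$. *)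

(* Defs.v *)
From HB Require Import structures.
From mathcomp Require Import all_boot all_order all_algebra.
From mathcomp Require Import all_classical all_reals all_analysis.
Set Implicit Arguments. Unset Strict Implicit. Unset Printing Implicit Defensive.
Import Order.TTheory GRing.Theory Num.Theory.
Import numFieldNormedType.Exports.
Local Open Scope classical_set_scope.
Local Open Scope ring_scope.

(* A normed space V equipped with its Borel sigma-algebra (generated by the
   open sets); Borel V is definitionally V. *)
Definition Borel (R : realType) (V : normedModType R) := g_sigma_algebraType (@open V).

Definition log2 (R : realType) (x : R) : R := ln x / ln 2.

Definition vdist (R : realType) (V : normedModType R) (z x : V) : R := `|z - x|.

(* square root on extended reals (only applied to nonnegative quantities) *)
Definition esqrt (R : realType) (x : \bar R) : \bar R :=
  match x with
  | EFin r => (Num.sqrt r)%:E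
  | EPInf => +oo%E
  | ENInf => 0%E
  end.

Definition is_density (R : realType) (V : normedModType R)
  (mu : {measure set (Borel V) -> \bar R}) (Z : set (Borel V)) (f : V -> R) : Prop :=
  measurable_fun Z (f : Borel V -> R) /\ (forall z, Z z -> 0 <= f z) /\
  (\int[mu]_(z in Z) (f z)%:E = 1)%E.

(* epsilon-LDP mechanism q(z | x) = q x z from X to Z *)
Definition is_LDP (R : realType) (V : Type) (X Z : set V) (q : V -> V -> R)
  (eps : R) : Prop :=
  forall x x' z, X x -> X x' -> Z z -> q x z <= expR eps * q x' z.

Definition iid_candidates (R : realType) (V : normedModType R)
  (mu : {measure set (Borel V) -> \bar R}) (Z : set (Borel V)) (p : V -> R)
  d (Omega : measurableType d) (P : probability Omega R) (N : nat)
  (Zc : 'I_N -> Omega -> Borel V) : Prop :=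
  (forall k, measurable_fun setT (Zc k)) /\
  forall A : 'I_N -> set (Borel V), (forall k, measurable (A k)) ->
    P (\bigcap_(k in [set: 'I_N]) (Zc k @^-1` A k)) =
    (\prod_(k < N) \int[mu]_(z in A k `&` Z) (p z)%:E)%E.

Definition mrc_weight (R : realType) (V : Type) (q : V -> V -> R) (p : V -> R)
  (x : V) N (zs : 'I_N -> V) (k : 'I_N) : R := q x (zs k) / p (zs k).

Definition mrc_prob (R : realType) (V : Type) (q : V -> V -> R) (p : V -> R)
  (x : V) N (zs : 'I_N -> V) (k : 'I_N) : R :=
  mrc_weight q p x zs k / \sum_(k' < N) mrc_weight q p x zs k'.

Definition mrc_sq_error (R : realType) (V : normedModType R) (q : V -> V -> R)
  (p : V -> R) (x : V) N (zs : 'I_N -> V) : R :=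
  \sum_(k < N) mrc_prob q p x zs k * vdist (zs k) x ^+ 2.

(* Main.v *)
Require Import Defs.
From HB Require Import structures.
From mathcomp Require Import all_boot all_order all_algebra.
From mathcomp Require Import all_classical all_reals all_analysis.
From mathcomp Require Import measurable_realfun ring lra.
Import Order.TTheory GRing.Theory Num.Theory.
Import numFieldNormedType.Exports.
Local Open Scope classical_set_scope.
Local Open Scope ring_scope.

(** Because [|ln (q / p)| <= eps], the importance weights [rho = q / p] are at most
    [expR eps], so the empirical mean of [rho * f] over [N] i.i.d. draws from [p]
    has mean [E_q f] and variance at most [expR eps / N * E_q (f ^+ 2)]. For the
    given [N] one has [expR eps / N = 2 `^ (- 4 * c * eps) <= alpha ^+ 8]: no tail
    bound on [ln rho] is needed, and Chebyshev at level [alpha] bounds both the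
    deviation for [f = |z - x| ^+ 2] and that for [f = 1] by probability [alpha]
    (when [2 * alpha < 1], the only nontrivial case). The MRC error is the quotient
    of these two empirical means. *)

(** * Integration against a measure given by a density *)

Section density.
Context (d : measure_display) (T : measurableType d) (R : realType).
Variables (mu nu : {measure set T -> \bar R}) (D : set T) (p : T -> R).
Hypotheses (mD : measurable D) (mp : measurable_fun D p).
Hypothesis p0 : forall z, D z -> 0 <= p z.
Hypothesis nuE : forall A, measurable A ->
  nu A = (\int[mu]_(z in A `&` D) (p z)%:E)%E.

Import HBNNSimple.
Local Open Scope ereal_scope.

(** A simple function is a finite nonnegative combination of indicators of its level sets, and on
    each level set the identity is [nuE]. *)
Let density_nnsfun (h : {nnsfun T >-> R}) :
  \int[nu]_z (h z)%:E = \int[mu]_(z in D) ((h z)%:E * (p z)%:E).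
Proof.
have mpE : measurable_fun D (EFin \o p) by exact/measurable_EFinP.
under [RHS]eq_integral => z zD.
  rewrite fimfunE -fsumEFin// ge0_mule_fsuml; last first.
    by move=> r; exact: nnfun_muleindic_ge0.
  over.
rewrite ge0_integral_fsum//; last 2 first.
- move=> r; apply: emeasurable_funM => //.
  by apply/measurable_EFinP/measurable_funM.
- by move=> r z Dz; rewrite mule_ge0 ?lee_fin ?p0// -lee_fin nnfun_muleindic_ge0.
rewrite integralT_nnsfun sintegralE; apply: eq_fsbigr => r rh.
under eq_integral do rewrite EFinM -muleA.
rewrite ge0_integralZl//.
- rewrite nuE//; congr (_ * _); rewrite integral_mkcondl.
  by apply: eq_integral => z _; rewrite epatch_indic muleC.
- by apply: emeasurable_funM => //; exact/measurable_EFinP.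
- by move=> t Et; rewrite mule_ge0 ?lee_fin ?p0.
- by move: rh; rewrite inE => -[t _ <-]; rewrite lee_fin.
Qed.

(** Extends the simple case by monotone convergence along [nnsfun_approx], applied once under [nu]
    and once under [mu]. This turns expectations over a candidate into integrals against [p]. *)
Lemma ge0_integral_density (h : T -> \bar R) :
  measurable_fun setT h -> (forall z, 0 <= h z) ->
  \int[nu]_z h z = \int[mu]_(z in D) (h z * (p z)%:E).
Proof.
move=> mh h0; pose g := nnsfun_approx measurableT mh.
have gh z : EFin \o g^~ z @ \oo --> h z by exact: cvg_nnsfun_approx.
have ndg z : nondecreasing_seq (fun n => (g n z)%:E).
  by move=> a b ab; rewrite lee_fin; exact/lefP/nd_nnsfun_approx.
transitivity (limn (fun n => \int[nu]_z (g n z)%:E)).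
  rewrite -monotone_convergence//.
  - by apply: eq_integral => z _; apply/esym/cvg_lim => //; exact: gh.
  - by move=> n; exact/measurable_EFinP.
  - by move=> n z _; rewrite lee_fin.
under eq_fun do rewrite density_nnsfun.
rewrite -monotone_convergence//.
- apply: eq_integral => z _; apply/cvg_lim => //.
  by apply: cvgeZr => //; exact: gh.
- move=> n; apply: emeasurable_funM; last exact/measurable_EFinP.
  by apply/measurable_EFinP; exact: measurable_funTS.
- by move=> n z Dz; rewrite mule_ge0 ?lee_fin ?p0.
- by move=> z Dz a b ab; rewrite lee_wpmul2r ?lee_fin ?p0// -lee_fin; exact: ndg.
Qed.

End density.

(** * Products of functions of two independent variables *)

Section independence.
Context (d d' : measure_display) (Omega : measurableType d)
  (T : measurableType d') (R : realType) (P : probability Omega R).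
Local Open Scope ereal_scope.

(** Independence makes the joint law agree with the product of the marginal laws on rectangles,
    hence everywhere by uniqueness of the product measure. Tonelli then splits the integral. *)
Lemma ge0_integral_indep (X Y : Omega -> T) (g h : T -> \bar R) :
  measurable_fun setT X -> measurable_fun setT Y ->
  (forall A B, measurable A -> measurable B ->
    P (X @^-1` A `&` Y @^-1` B) = P (X @^-1` A) * P (Y @^-1` B)) ->
  measurable_fun setT g -> measurable_fun setT h ->
  (forall z, 0 <= g z) -> (forall z, 0 <= h z) ->
  \int[P]_w (g (X w) * h (Y w)) = \int[P]_w g (X w) * \int[P]_w h (Y w).
Proof.
move=> mX mY XY mg mh g0 h0.
pose X' : {mfun Omega >-> T} := HB.pack X (isMeasurableFun.Build _ _ _ _ _ mX).
pose Y' : {mfun Omega >-> T} := HB.pack Y (isMeasurableFun.Build _ _ _ _ _ mY).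
pose XY' : {mfun Omega >-> (T * T)%type} :=
  HB.pack (fun w => (X w, Y w))
    (isMeasurableFun.Build _ _ _ _ _ (measurable_fun_pair mX mY)).
pose PX := distribution P X'; pose PY := distribution P Y'.
pose PXY := distribution P XY'.
have mgh : measurable_fun setT (fun z : T * T => g z.1 * h z.2).
  by apply: emeasurable_funM; exact: measurableT_comp.
have gh0 (z : T * T) : 0 <= g z.1 * h z.2 by exact: mule_ge0.
have -> : \int[P]_w (g (X w) * h (Y w)) = \int[PXY]_z (g z.1 * h z.2).
  by rewrite /PXY ge0_integral_distribution.
have -> : \int[PXY]_z (g z.1 * h z.2) = \int[PX \x PY]_z (g z.1 * h z.2).
  apply: eq_measure_integral => A mA _; apply/esym.
  by apply: product_measure_unique => // B C mB mC; exact: XY.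
rewrite fubini_tonelli1// /fubini_F/=.
under eq_integral do rewrite ge0_integralZl//.
rewrite ge0_integralZr ?integral_ge0//.
by rewrite /PX /PY !ge0_integral_distribution.
Qed.

End independence.

(** * Variance of a sum and Chebyshev's inequality *)

Section second_moment.
Context (d : measure_display) (Omega : measurableType d) (R : realType)
  (P : probability Omega R).

(** The variance of a sum of pairwise uncorrelated variables is the sum of the variances, each of
    which is at most the second-moment bound [s]. *)
Lemma second_moment_sum_le (N : nat) (X : 'I_N -> Omega -> R) (m s : R) :
  (forall k, measurable_fun setT (X k)) -> (forall k w, 0 <= X k w) ->
  0 <= m -> 0 <= s ->
  (forall k, \int[P]_w (X k w)%:E = m%:E)%E ->
  (forall k, \int[P]_w (X k w ^+ 2)%:E <= s%:E)%E ->
  (forall i j, i != j -> \int[P]_w (X i w * X j w)%:E = (m ^+ 2)%:E)%E ->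
  (\int[P]_w ((\sum_(k < N) X k w - N%:R * m) ^+ 2)%:E <= (N%:R * s)%:E)%E.
Proof.
move=> mX X0 m0 s0 Em Es Eij; pose n : R := N%:R; rewrite -/n.
have n0 : 0 <= n by exact: ler0n.
pose S w := \sum_(k < N) X k w.
have mS : measurable_fun setT S by exact: measurable_sum.
have S0 w : 0 <= S w by exact: sumr_ge0.
have mD : measurable_fun setT (fun w => (S w - n * m) ^+ 2).
  by apply: measurable_funX; exact: measurable_funB.
have ES : (\int[P]_w (S w)%:E = (n * m)%:E)%E.
  under eq_integral do rewrite /S -sumEFin.
  rewrite ge0_integral_sum//; last 2 first.
  - by move=> k; exact/measurable_EFinP.
  - by move=> k w _; rewrite lee_fin.
  under eq_bigr do rewrite Em.
  by rewrite sumEFin sumr_const card_ord -mulr_natl.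
have ES2 : (\int[P]_w (S w ^+ 2)%:E <= (n ^+ 2 * m ^+ 2 + n * s)%:E)%E.
  have mXX i j : measurable_fun setT (fun w => X i w * X j w).
    exact: measurable_funM.
  under eq_integral.
    move=> w _.
    have -> : S w ^+ 2 = \sum_(k : 'I_N * 'I_N) X k.1 w * X k.2 w.
      rewrite expr2 /S big_distrl/= -(pair_bigA _ (fun i j => X i w * X j w))/=.
      by apply: eq_bigr => i _; rewrite big_distrr.
    rewrite -sumEFin; over.
  rewrite ge0_integral_sum//; last 2 first.
  - by move=> k; exact/measurable_EFinP.
  - by move=> k w _; rewrite lee_fin mulr_ge0.
  (* Every one of the [N ^ 2] pairs is charged [m ^+ 2], and each of the [N] diagonal pairs an extra
     [s]. The surplus [m ^+ 2] on the diagonal makes the first part exactly the squared mean, which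
     cancels later. *)
  apply: (@le_trans _ _
    (\sum_(k : 'I_N * 'I_N) (m ^+ 2 + (k.1 == k.2)%:R * s)%:E)%E).
    apply: lee_sum => -[i j] _ /=; have [->|ij] := eqVneq i j; last first.
      by rewrite Eij// mul0r addr0.
    under eq_integral do rewrite -expr2.
    by apply: (le_trans (Es _)); rewrite lee_fin mul1r lerDr sqr_ge0.
  rewrite sumEFin lee_fin -(pair_bigA _ (fun i j => m ^+ 2 + (i == j)%:R * s))/=.
  under eq_bigr.
    move=> i _; rewrite big_split/= sumr_const card_ord -mulr_suml.
    rewrite (bigD1 i)//= eqxx big1 ?addr0; last first.
      by move=> j; rewrite eq_sym => /negbTE ->.
    over.
  rewrite sumr_const card_ord mul1r -[leLHS]mulr_natl -[m ^+ 2 *+ N]mulr_natl.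
  by rewrite -/n mulrDr mulrA -expr2.
(* The expanded square with its negative cross term moved to the left: only nonnegative functions
   are integrated, so additivity holds without an integrability argument. *)
have key : (\int[P]_w ((S w - n * m) ^+ 2)%:E + (2 * n * m * (n * m))%:E =
    \int[P]_w (S w ^+ 2)%:E + ((n * m) ^+ 2)%:E)%E.
  rewrite EFinM -ES -ge0_integralZl//; last 3 first.
  - exact/measurable_EFinP.
  - by move=> w _; rewrite lee_fin.
  - by rewrite lee_fin !mulr_ge0.
  have -> : ((n * m) ^+ 2)%:E = (\int[P]_w (cst ((n * m) ^+ 2)%:E w))%E.
    by rewrite integral_cst// [X in (_ * X)%E]probability_setT mule1.
  rewrite -!ge0_integralD//.
  - by apply: eq_integral => w _; rewrite -EFinM -!EFinD; congr EFin; ring.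
  - by move=> w _; rewrite lee_fin sqr_ge0.
  - by apply/measurable_EFinP; exact: measurable_funX.
  - by move=> w _; rewrite lee_fin sqr_ge0.
  - by move=> w _; rewrite lee_fin sqr_ge0.
  - exact/measurable_EFinP.
  - by move=> w _; rewrite -EFinM lee_fin !mulr_ge0.
  - by apply: measurable_funeM; exact/measurable_EFinP.
rewrite -(leeD2rE (x := (2 * n * m * (n * m))%:E))// key.
apply: (le_trans (leeD2r _ ES2)).
by rewrite -!EFinD lee_fin; lra.
Qed.

Lemma measurable_norm_gt (D : Omega -> R) (r : R) : measurable_fun setT D ->
  measurable [set w | (r < `|D w|)%R].
Proof.
move=> mD; have mN : measurable_fun setT (fun w => `|D w|).
  exact: measurableT_comp.
by rewrite -preimage_itvoy -[X in measurable X]setTI; exact: mN.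
Qed.

(** Measuring the deviation in units of [Num.sqrt S] makes [S] cancel from the probability bound, so
    one bound serves test functions with different second moments. *)
Lemma chebyshev_sqrt (D : Omega -> R) (a b S : R) :
  measurable_fun setT D -> 0 < a -> 0 <= b -> 0 <= S ->
  (\int[P]_w (D w ^+ 2)%:E <= (b * S)%:E)%E ->
  (P [set w | (a * Num.sqrt S < `|D w|)%R] <= (b / a ^+ 2)%:E)%E.
Proof.
move=> mD a0 b0 S0 ED.
have mDD : measurable_fun setT (fun w => D w ^+ 2) by exact: measurable_funX.
have mA (r : R) : measurable [set w | (r < `|D w|)%R].
  exact: measurable_norm_gt.
have ba0 : 0 <= b / a ^+ 2 by rewrite divr_ge0// sqr_ge0.
(* At [S = 0] the threshold is zero and cannot be divided by. Instead [D ^+ 2] has integral zero, so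
   [D] vanishes outside a null set. *)
have [S00|Sneq0] := eqVneq S 0.
  rewrite S00 sqrtr0 mulr0.
  have : (\int[P]_w `|(D w ^+ 2)%:E| = 0)%E.
    apply/eqP; rewrite eq_le integral_ge0 ?andbT//.
    rewrite S00 mulr0 in ED; apply: le_trans ED.
    by under eq_integral do rewrite gee0_abs ?lee_fin ?sqr_ge0//.
  move/(ae_eq_integral_abs _ measurableT).
  move=> /(_ ltac:(exact/measurable_EFinP)) [B [mB PB0 DB]].
  suff -> : P [set w | (0 < `|D w|)%R] = 0%E by rewrite lee_fin.
  apply: (subset_measure0 _ mB _ PB0) => // w /= Dw; apply: DB => /= /(_ I)[].
  by move/eqP; rewrite sqrf_eq0 -normr_eq0 gt_eqF.
have S0' : 0 < S by rewrite lt0r Sneq0.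
have r0 : 0 < a * Num.sqrt S by rewrite mulr_gt0// sqrtr_gt0.
set r := a * Num.sqrt S in r0 *.
have r2 : r ^+ 2 = a ^+ 2 * S by rewrite exprMn sqr_sqrtr.
have : ((r ^+ 2)%:E * P [set w | (r < `|D w|)%R] <= (b * S)%:E)%E.
  apply: le_trans ED.
  rewrite -integral_cst//.
  apply: (@le_trans _ _ (\int[P]_(w in [set w | (r < `|D w|)%R]) (D w ^+ 2)%:E)%E).
    apply: ge0_le_integral => //.
    - by move=> w _; rewrite lee_fin sqr_ge0.
    - by apply/measurable_EFinP; exact: measurable_funTS.
    - move=> w /= rD; rewrite lee_fin -[leRHS]real_normK ?num_real//.
      by rewrite ler_sqr ?nnegrE// ?ltW.
  apply: ge0_subset_integral => //.
  - exact/measurable_EFinP.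
  - by move=> w _; rewrite lee_fin sqr_ge0.
rewrite muleC -lee_pdivlMr ?exprn_gt0// => /le_trans; apply.
rewrite -EFinM lee_fin r2 le_eqVlt; apply/orP; left; apply/eqP.
by field; rewrite Sneq0 gt_eqF.
Qed.

End second_moment.

(** * Importance sampling with i.i.d. candidates *)

Section importance_sampling.
Context (d d' : measure_display) (Omega : measurableType d)
  (T : measurableType d') (R : realType) (P : probability Omega R).
Variables (mu : {measure set T -> \bar R}) (Z : set T) (q p : T -> R) (M : R).
Variables (N : nat) (X : 'I_N -> Omega -> T).
Hypotheses (mZ : measurable Z) (mq : measurable_fun Z q)
  (mp : measurable_fun Z p).
Hypotheses (q0 : forall z, Z z -> 0 <= q z) (p0 : forall z, Z z -> 0 < p z).
Hypothesis intp : (\int[mu]_(z in Z) (p z)%:E = 1)%E.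
Hypothesis qpM : forall z, Z z -> q z / p z <= M.
Hypothesis mX : forall k, measurable_fun setT (X k).
Hypothesis iidX : forall A : 'I_N -> set T, (forall k, measurable (A k)) ->
  P (\bigcap_(k in [set: 'I_N]) (X k @^-1` A k)) =
  (\prod_(k < N) \int[mu]_(z in A k `&` Z) (p z)%:E)%E.
Local Open Scope ereal_scope.

(** The product formula with [setT] in every other coordinate; those factors equal 1 by [intp]. *)
Lemma iid_marginal k A : measurable A ->
  P (X k @^-1` A) = \int[mu]_(z in A `&` Z) (p z)%:E.
Proof.
move=> mA; pose B l := if l == k then A else setT.
have mB l : measurable (B l) by rewrite /B; case: ifP.
have := iidX _ mB; rewrite (bigD1 k)//= big1 ?mule1; last first.
  by move=> l /negbTE lk; rewrite /B lk setTI.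
rewrite /B eqxx => <-; congr (P _); apply/seteqP; split => w /=.
  by move=> Aw l _ /=; case: ifPn => // /eqP ->.
by move=> /(_ k I); rewrite eqxx.
Qed.

Lemma iid_pairwise i j A B : i != j -> measurable A -> measurable B ->
  P (X i @^-1` A `&` X j @^-1` B) = P (X i @^-1` A) * P (X j @^-1` B).
Proof.
move=> ij mA mB; have ji : (j == i) = false by rewrite eq_sym; exact/negbTE.
pose C l := if l == i then A else if l == j then B else setT.
have mC l : measurable (C l) by rewrite /C; case: ifP => //; case: ifP.
have := iidX _ mC; rewrite (bigD1 i)//= (bigD1 j) ?ji//= big1 ?mule1; last first.
  by move=> l /andP[/negbTE li /negbTE lj]; rewrite /C li lj setTI.
rewrite /C eqxx ji eqxx (iid_marginal i A)// (iid_marginal j B)// => <-; congr (P _).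
apply/seteqP; split => w /=.
  by move=> [Aw Bw] l _ /=; case: ifPn => [/eqP ->//|_]; case: ifPn => [/eqP ->|].
by move=> CX; split; [have := CX i I|have := CX j I]; rewrite ?ji eqxx.
Qed.

(** By [iid_marginal] the law of [X k] has density [p] on [Z] with respect to [mu]. *)
Lemma ge0_integral_iid k (h : T -> \bar R) :
  measurable_fun setT h -> (forall z, 0 <= h z) ->
  \int[P]_w h (X k w) = \int[mu]_(z in Z) (h z * (p z)%:E).
Proof.
move=> mh h0.
pose Xk : {mfun Omega >-> T} :=
  HB.pack (X k) (isMeasurableFun.Build _ _ _ _ _ (mX k)).
rewrite -(@ge0_integral_density _ _ _ mu (distribution P Xk))//.
- by rewrite ge0_integral_distribution.
- by move=> z Zz; exact/ltW/p0.
- by move=> A mA; exact: iid_marginal.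
Qed.

(** Extension by zero outside [Z] gives a function measurable on all of [T], although [q] and [p]
    are controlled only on [Z]. *)
Definition importance_weight (f : T -> R) : T -> R :=
  (fun z => q z / p z * f z)%R \_ Z.

Section weight.
Variable f : T -> R.
Hypotheses (mf : measurable_fun setT f) (f0 : forall z, (0 <= f z)%R).

Lemma measurable_importance_weight : measurable_fun setT (importance_weight f).
Proof.
apply/(measurable_restrictT _ mZ); apply: measurable_funM; last first.
  exact: measurable_funTS.
apply: measurable_funM => //.
(* Measurability of the inverse comes from that of the real power with exponent -1; the two agree on
   [Z], where [p] is positive. *)
have mpV : measurable_fun Z (fun z => p z `^ (-1))%R.
  exact: (measurableT_comp (measurable_powR _) mp).
by apply: eq_measurable_fun mpV => z /[!inE] Zz; have pz := p0 _ Zz; rewrite powR_inv1// ltW.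
Qed.

Lemma importance_weight_ge0 z : (0 <= importance_weight f z)%R.
Proof.
rewrite /importance_weight patchE; case: ifPn => // /[!inE] Zz.
by rewrite !mulr_ge0 ?invr_ge0 ?q0// ltW// p0.
Qed.

(** Unbiasedness: the density [p] of the candidate cancels the denominator of the weight. *)
Lemma integral_importance_weight k :
  \int[P]_w (importance_weight f (X k w))%:E = \int[mu]_(z in Z) (q z * f z)%:E.
Proof.
rewrite (@ge0_integral_iid _ (EFin \o importance_weight f)).
- apply: eq_integral => z Zz; rewrite /= /importance_weight patchE Zz -EFinM.
  congr EFin; have := p0 _ (set_mem Zz) => /lt0r_neq0 pz.
  by rewrite mulrAC divfK.
- by apply/measurable_EFinP; exact: measurable_importance_weight.
- by move=> z; rewrite lee_fin importance_weight_ge0.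
Qed.

(** Of the two factors [q / p] in the square, one is cancelled by the density [p] and the other is
    bounded by [M]. *)
Lemma integral_sqr_importance_weight_le k : (0 <= M)%R ->
  \int[P]_w (importance_weight f (X k w) ^+ 2)%:E <=
  M%:E * \int[mu]_(z in Z) (q z * f z ^+ 2)%:E.
Proof.
move=> M0.
have mqf : measurable_fun Z (fun z => q z * f z ^+ 2)%R.
  apply: measurable_funM => //; apply: measurable_funX.
  exact: measurable_funTS.
rewrite (@ge0_integral_iid _ (fun z => (importance_weight f z ^+ 2)%:E)).
- rewrite -ge0_integralZl//; last 2 first.
  + exact/measurable_EFinP.
  + by move=> z Zz; rewrite lee_fin mulr_ge0 ?q0// sqr_ge0.
  apply: ge0_le_integral => //.
  + by move=> z Zz; rewrite -EFinM lee_fin mulr_ge0 ?sqr_ge0// ltW// p0.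
  + apply: emeasurable_funM; last exact/measurable_EFinP.
    apply/measurable_EFinP/measurable_funX/measurable_funTS.
    exact: measurable_importance_weight.
  + by apply: measurable_funeM; exact/measurable_EFinP.
  + move=> z Zz; rewrite -!EFinM lee_fin /importance_weight patchE mem_set//.
    have pz := lt0r_neq0 (p0 _ Zz).
    have -> : ((q z / p z * f z) ^+ 2 * p z = q z / p z * (q z * f z ^+ 2))%R.
      by field.
    by rewrite ler_wpM2r ?qpM// mulr_ge0 ?q0// sqr_ge0.
- apply/measurable_EFinP/measurable_funX.
  exact: measurable_importance_weight.
- by move=> z; rewrite lee_fin sqr_ge0.
Qed.

(** Pairwise independence gives cross moments [m ^+ 2], so the empirical mean has variance at most
    [M * S / N]; Chebyshev applies with [b = M / N]. *)
Lemma importance_sampling_deviation (a m S : R) : (0 < N)%N -> (0 < a)%R ->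
  (0 <= M)%R ->
  \int[mu]_(z in Z) (q z * f z)%:E = m%:E ->
  \int[mu]_(z in Z) (q z * f z ^+ 2)%:E = S%:E ->
  P [set w | (a * Num.sqrt S <
     `|(\sum_(k < N) importance_weight f (X k w)) / N%:R - m|)%R] <=
  (M / N%:R / a ^+ 2)%:E.
Proof.
move=> N0 a0 M0 Em ES.
have m0 : (0 <= m)%R.
  by rewrite -lee_fin -Em integral_ge0// => z Zz; rewrite lee_fin mulr_ge0 ?q0.
have S0 : (0 <= S)%R.
  rewrite -lee_fin -ES integral_ge0// => z Zz.
  by rewrite lee_fin mulr_ge0 ?q0 ?sqr_ge0.
have Npos : (0 < N%:R :> R)%R by rewrite ltr0n.
have mg := measurable_importance_weight.
have mgX k : measurable_fun setT (fun w => importance_weight f (X k w)).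
  exact: measurableT_comp (mX k).
have mS : measurable_fun setT (fun w => \sum_(k < N) importance_weight f (X k w))%R.
  exact: measurable_sum.
apply: chebyshev_sqrt => //.
- by apply: measurable_funB => //; apply: measurable_funM.
- by rewrite divr_ge0// ltW.
have := @second_moment_sum_le _ _ _ P N
  (fun k w => importance_weight f (X k w)) m (M * S)%R mgX.
move=> /(_ (fun k w => importance_weight_ge0 _) m0 (mulr_ge0 M0 S0)).
have H1 k : \int[P]_w (importance_weight f (X k w))%:E = m%:E.
  by rewrite integral_importance_weight.
have H2 k : \int[P]_w (importance_weight f (X k w) ^+ 2)%:E <= (M * S)%:E.
  by rewrite EFinM -ES; exact: integral_sqr_importance_weight_le.
have H3 i j : i != j ->
    \int[P]_w (importance_weight f (X i w) * importance_weight f (X j w))%:E =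
    (m ^+ 2)%:E.
  move=> ij; under eq_integral do rewrite EFinM.
  rewrite (@ge0_integral_indep _ _ _ _ _ P (X i) (X j)
    (EFin \o importance_weight f) (EFin \o importance_weight f))//.
  - by rewrite /= !H1 -EFinM expr2.
  - by move=> A B mA mB; exact: iid_pairwise.
  - exact/measurable_EFinP.
  - exact/measurable_EFinP.
  - by move=> z; rewrite lee_fin importance_weight_ge0.
  - by move=> z; rewrite lee_fin importance_weight_ge0.
move=> /(_ H1 H2 H3) H.
under eq_integral.
  move=> w _.
  rewrite (_ : (_ / _ - _) ^+ 2 = N%:R ^- 2 *
    (\sum_(k < N) importance_weight f (X k w) - N%:R * m) ^+ 2)%R; last first.
    by field; rewrite gt_eqF.
  rewrite EFinM; over.
rewrite ge0_integralZl//; last 2 first.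
- by apply/measurable_EFinP/measurable_funX; exact: measurable_funB.
- by move=> w _; rewrite lee_fin sqr_ge0.
apply: le_trans (lee_wpmul2l _ H) _; first by rewrite lee_fin invr_ge0 sqr_ge0.
rewrite -EFinM lee_fin le_eqVlt; apply/orP; left; apply/eqP.
by field; rewrite gt_eqF.
Qed.

End weight.
End importance_sampling.

(** * Measurability, moment and real-number estimates for the MRC bound *)

Lemma measurable_vdist (R : realType) (V : normedModType R) (x : V) :
  measurable_fun setT ((fun z => vdist z x) : Borel V -> R).
Proof.
have /continuousP cf : continuous (fun z : V => vdist z x).
  by move=> z; apply: cvg_norm; apply: cvgB; [exact: cvg_id|exact: cvg_cst].
apply: (measurability _ (RGenOpens.measurableE R)) => _ [_ [a [b ->] <-]].
by rewrite setTI; apply: sub_sigma_algebra; exact/cf/interval_open.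
Qed.

(* Integrating [2 t f <= f ^+ 2 + t ^+ 2] against [q], first with [t = 1] to get
   finiteness and then with [t = m]. *)
Lemma density_mean_le_sqrt (d : measure_display) (T : measurableType d)
  (R : realType) (mu : {measure set T -> \bar R}) (Z : set T) (q f : T -> R)
  (S : R) :
  measurable Z -> measurable_fun Z q -> (forall z, Z z -> 0 <= q z) ->
  (\int[mu]_(z in Z) (q z)%:E = 1)%E ->
  measurable_fun setT f -> (forall z, 0 <= f z) ->
  (\int[mu]_(z in Z) (q z * f z ^+ 2)%:E = S%:E)%E ->
  exists2 m : R, (\int[mu]_(z in Z) (q z * f z)%:E = m%:E)%E &
    0 <= m <= Num.sqrt S.
Proof.
move=> mZ mq q0 intq mf f0 ES.
have mfZ : measurable_fun Z f by exact: measurable_funTS.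
have mqf : measurable_fun Z (fun z => q z * f z) by exact: measurable_funM.
have mqf2 : measurable_fun Z (fun z => q z * f z ^+ 2).
  by apply: measurable_funM => //; exact: measurable_funX.
have I0 : (0 <= \int[mu]_(z in Z) (q z * f z)%:E)%E.
  by apply: integral_ge0 => z Zz; rewrite lee_fin mulr_ge0 ?q0.
have key (t : R) : 0 <= t ->
    ((2 * t)%:E * \int[mu]_(z in Z) (q z * f z)%:E <= (S + t ^+ 2)%:E)%E.
  move=> t0; have t20 : 0 <= t ^+ 2 by exact: sqr_ge0.
  have -> : ((S + t ^+ 2)%:E =
      \int[mu]_(z in Z) ((q z * f z ^+ 2)%:E + (t ^+ 2)%:E * (q z)%:E))%E.
    rewrite ge0_integralD//.
    - rewrite ES ge0_integralZl//.
      + by rewrite [X in (_ * X)%E]intq mule1.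
      + exact/measurable_EFinP.
    - by move=> z Zz; rewrite lee_fin mulr_ge0 ?q0 ?sqr_ge0.
    - exact/measurable_EFinP.
    - by move=> z Zz; rewrite -EFinM lee_fin mulr_ge0 ?q0.
    - by apply: measurable_funeM; exact/measurable_EFinP.
  rewrite -ge0_integralZl//.
  - apply: ge0_le_integral => //.
    + by move=> z Zz; rewrite -EFinM lee_fin !mulr_ge0 ?q0.
    + by apply: measurable_funeM; exact/measurable_EFinP.
    + apply: emeasurable_funD; first exact/measurable_EFinP.
      by apply: measurable_funeM; exact/measurable_EFinP.
    + move=> z Zz; rewrite -!EFinM -EFinD lee_fin -subr_ge0.
      rewrite (_ : _ - _ = q z * (f z - t) ^+ 2); last by ring.
      by rewrite mulr_ge0 ?q0 ?sqr_ge0.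
  - exact/measurable_EFinP.
  - by move=> z Zz; rewrite lee_fin mulr_ge0 ?q0.
  - by rewrite lee_fin mulr_ge0.
case I : (\int[mu]_(z in Z) (q z * f z)%:E)%E I0 key => [m| |] I0 key //.
  exists m => //; rewrite lee_fin in I0; rewrite I0/=.
  have := key m I0; rewrite -EFinM lee_fin => km.
  rewrite -(ger0_norm I0) -sqrtr_sqr ler_wsqrtr//.
  by rewrite -subr_ge0 (_ : _ - _ = S + m ^+ 2 - 2 * m * m) ?subr_ge0//; ring.
by have := key 1 ler01; rewrite mulr1 gt0_muley ?lte_fin// leye_eq.
Qed.

(** Write [A / W - m] as [(A - m - m * (W - 1)) / W]. Each half of the numerator is at most [a * s],
    the second because [m <= s], and [W] is at least [1 - a]. *)
Lemma ratio_estimate (R : realFieldType) (A W m s a : R) :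
  `|A - m| <= a * s -> `|W - 1| <= a -> a < 1 -> 0 <= m <= s ->
  `|A / W - m| <= 2 * a / (1 - a) * s.
Proof.
move=> Am W1 a1 /andP[m0 ms].
have a0 : 0 <= a by exact: le_trans W1.
have Wa : 1 - a <= W by move: W1; rewrite ler_norml => /andP[]; lra.
have W0 : 0 < W by lra.
have -> : A / W - m = (A - m - m * (W - 1)) / W by field; rewrite gt_eqF.
rewrite normrM normfV (gtr0_norm W0) ler_pdivrMr//.
have mW : `|m * (W - 1)| <= s * a.
  by rewrite normrM (ger0_norm m0) ler_pM.
apply: (le_trans (ler_normB _ _)); apply: (le_trans (lerD Am mW)).
have as0 : 0 <= 2 * a / (1 - a) * s.
  rewrite mulr_ge0 ?(le_trans m0 ms)// divr_ge0 ?mulr_ge0//.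
  by rewrite subr_ge0 ltW.
apply: le_trans (ler_wpM2l as0 Wa); rewrite le_eqVlt; apply/orP; left; apply/eqP.
by field; rewrite subr_eq0 gt_eqF.
Qed.

(** The part [log2 (expR 1) * eps] of the exponent contributes a factor [expR eps] to [N], which
    cancels the numerator; the part [4 * c * eps] gives the fourth power. *)
Lemma mrc_candidate_ratio (R : realType) (eps c : R) (N : nat) :
  N%:R = 2 `^ ((log2 (expR 1) + 4 * c) * eps) ->
  expR eps / N%:R = (2 `^ (- (c * eps))) ^+ 4.
Proof.
have pw (y : R) : 2 `^ y = expR (y * ln 2) by rewrite /powR pnatr_eq0.
have l2 : ln (2 : R) != 0 by rewrite gt_eqF// ln_gt0// ltr1n.
move=> ->; rewrite !pw /log2 expRK -expRB -expRM_natl; congr expR.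
by field.
Qed.

Theorem theorem1 (R : realType) (V : normedModType R)
  (mu : {measure set (Borel V) -> \bar R})
  (X Z : set (Borel V)) (x : V) (q : V -> V -> R) (p : V -> R)
  (eps c : R) (N : nat) :
  measurable Z ->
  X x ->
  (forall x', X x' -> is_density mu Z (q x')) ->
  is_LDP X Z q eps ->
  is_density mu Z p ->
  (forall x' z, X x' -> Z z -> 0 < q x' z / p z /\ `|ln (q x' z / p z)| <= eps) ->
  0 <= c ->
  N%:R = 2 `^ ((log2 (expR 1) + 4 * c) * eps) ->
  let alpha := Num.sqrt (2 `^ (- (c * eps)) + 2 `^ (- (c ^+ 2 / log2 (expR 1)) + 1)) in
  forall d (Omega : measurableType d) (P : probability Omega R)
    (Zc : 'I_N -> Omega -> Borel V),
  iid_candidates mu Z p P Zc ->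
  exists E : set Omega, measurable E /\ (P E >= (1 - 2 * alpha)%:E)%E /\
    forall w, E w ->
      (`| (mrc_sq_error q p x (fun k => Zc k w))%:E
          - \int[mu]_(z in Z) (q x z * vdist z x ^+ 2)%:E |
       <= ((2 * alpha) / (1 - alpha))%:E
          * esqrt (\int[mu]_(z in Z) (q x z * vdist z x ^+ 4)%:E))%E.
Proof.
move=> mZ Xx dq _ [mp [p_ge0 intp]] qp _ NE alpha d Omega P Zc [mZc iid].
have [mq [q_ge0 intq]] := dq _ Xx.
(* Division by zero returns zero, so a zero of [p] would contradict the assumed positivity of the
   ratio. *)
have p_gt0 z : Z z -> 0 < p z.
  move=> Zz; rewrite lt0r p_ge0// andbT; apply/eqP => pz.
  by have [] := qp _ _ Xx Zz; rewrite pz invr0 mulr0 ltxx.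
have qpM z : Z z -> q x z / p z <= expR eps.
  move=> Zz; have [r0 rle] := qp _ _ Xx Zz.
  rewrite -[leLHS]lnK ?posrE// ler_expR; exact: le_trans (ler_norm _) rle.
have pw0 (y : R) : 0 < 2 `^ y by exact: powR_gt0.
have alpha2 : 2 `^ (- (c * eps)) <= alpha ^+ 2.
  by rewrite sqr_sqrtr ?addr_ge0 ?ltW// ltrDl.
have alpha0 : 0 < alpha by rewrite sqrtr_gt0 addr_gt0.
have N0 : (0 < N)%N by rewrite -(ltr0n R) NE.
(* If [1 <= 2 * alpha], the required probability is at most zero and the empty event suffices. *)
have [alpha12|alpha12] := leP 1 (2 * alpha).
  exists set0; split => //; split => //.
  by rewrite measure0 lee_fin subr_le0.
have alpha1 : alpha < 1 by lra.
(* After clearing [alpha ^+ 2], the claim follows from [alpha ^+ 8 <= alpha ^+ 3], which holds as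
   [alpha < 1]. *)
have tail : expR eps / N%:R / alpha ^+ 2 <= alpha.
  rewrite (mrc_candidate_ratio _ _ _ _ NE) ler_pdivrMr ?exprn_gt0//.
  apply: (@le_trans _ _ ((alpha ^+ 2) ^+ 4)).
    by rewrite lerXn2r// nnegrE ltW// exprn_gt0.
  rewrite -exprM -exprS; apply: ler_wiXn2l => //; exact: ltW.
(* With an infinite fourth moment the right-hand side is infinite, its coefficient being positive,
   and the whole space serves as event. *)
case I4 : (\int[mu]_(z in Z) (q x z * vdist z x ^+ 4)%:E)%E => [S| |]; last 2 first.
- exists setT; split => //; split.
    by rewrite probability_setT lee_fin; lra.
  by move=> w _ /=; rewrite gt0_muley ?leey// lte_fin divr_gt0//; lra.
- suff : (0 <= -oo :> \bar R)%E by [].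
  rewrite -I4; apply: integral_ge0 => z Zz.
  by rewrite lee_fin mulr_ge0 ?q_ge0// exprn_ge0// normr_ge0.
pose f z := vdist z x ^+ 2.
have mf : measurable_fun setT (f : Borel V -> R).
  by apply: measurable_funX; exact: measurable_vdist.
have f0 z : 0 <= f z by exact: sqr_ge0.
have ES : (\int[mu]_(z in Z) (q x z * f z ^+ 2)%:E = S%:E)%E.
  by rewrite -I4; apply: eq_integral => z _; rewrite /f -exprM.
have [m Em mS] := density_mean_le_sqrt _ _ _ _ _ _ _ _ mZ mq q_ge0 intq mf f0 ES.
(* The second test function: its weighted average is the MRC normaliser divided by [N], with mean
   and second moment both 1 under [q x]. *)
pose one : Borel V -> R := cst 1.
have m1 : measurable_fun setT one by exact: measurable_cst.
have one0 z : 0 <= one z by exact: ler01.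
have E1 : (\int[mu]_(z in Z) (q x z * one z)%:E = 1%:E)%E.
  by rewrite -intq; apply: eq_integral => z _; rewrite mulr1.
have E2 : (\int[mu]_(z in Z) (q x z * one z ^+ 2)%:E = 1%:E)%E.
  by rewrite -intq; apply: eq_integral => z _; rewrite expr1n mulr1.
have M0 := expR_ge0 eps.
pose wt := importance_weight _ _ _ Z (q x) p.
pose avg g w := (\sum_(k < N) wt g (Zc k w)) / N%:R.
have mavg g : measurable_fun setT (g : Borel V -> R) ->
    measurable_fun setT (avg g).
  move=> mg; apply: measurable_funM => //; apply: measurable_sum => k.
  by apply: measurableT_comp (mZc k); exact: measurable_importance_weight.
pose Bf := [set w | alpha * Num.sqrt S < `|avg f w - m|].
pose B1 := [set w | alpha * Num.sqrt 1 < `|avg one w - 1|].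
(* Almost surely all candidates lie in [Z]; there the zero-extended weights coincide with
   [mrc_weight]. *)
pose G := \bigcap_(k in [set: 'I_N]) (Zc k @^-1` Z).
have mBf : measurable Bf.
  by apply: measurable_norm_gt; apply: measurable_funB => //; exact: mavg.
have mB1 : measurable B1.
  by apply: measurable_norm_gt; apply: measurable_funB => //; exact: mavg.
have mG : measurable G.
  apply: fin_bigcap_measurable; first exact: finite_finset.
  by move=> k _; rewrite -[X in measurable X]setTI; exact: mZc.
have PBf : (P Bf <= alpha%:E)%E.
  apply: (@le_trans _ _ (expR eps / N%:R / alpha ^+ 2)%:E); last by rewrite lee_fin.
  exact: (importance_sampling_deviation _ _ _ _ _ _ mu).
have PB1 : (P B1 <= alpha%:E)%E.
  apply: (@le_trans _ _ (expR eps / N%:R / alpha ^+ 2)%:E); last by rewrite lee_fin.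
  exact: (importance_sampling_deviation _ _ _ _ _ _ mu).
have PG : P G = 1%E by rewrite /G iid// big1// => k _; rewrite setIid.
exists (~` (Bf `|` B1 `|` ~` G)).
have mB : measurable (Bf `|` B1 `|` ~` G).
  by apply: measurableU; [exact: measurableU|exact: measurableC].
split; first exact: measurableC.
split.
  rewrite probability_setC// EFinB leeB//.
  have PGC : P (~` G) = 0%E by rewrite probability_setC// PG subee.
  (* Union bound: [alpha] for each of [Bf] and [B1], and zero for the complement of [G]. *)
  apply: (@le_trans _ _ (P (Bf `|` B1) + P (~` G))%E).
    by apply: measureU2; [exact: measurableU|exact: measurableC].
  rewrite PGC adde0 mulr_natl mulr2n EFinD.
  by apply: (@le_trans _ _ (P Bf + P B1)%E); [exact: measureU2|exact: leeD].
move=> w; rewrite !setCU setCK => -[[/= nBf nB1] Gw].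
(* Self-normalisation: the factors [1 / N] of the two averages cancel in the quotient. *)
have -> : mrc_sq_error q p x (fun k => Zc k w) = avg f w / avg one w.
  have wtE g k : wt g (Zc k w) = mrc_weight q p x (Zc ^~ w) k * g (Zc k w).
    by rewrite /wt /importance_weight patchE mem_set//; exact: Gw.
  have -> : avg f w = \sum_k mrc_weight q p x (Zc ^~ w) k * f (Zc k w) / N%:R.
    by rewrite /avg mulr_suml; apply: eq_bigr => k _; rewrite wtE.
  have -> : avg one w = (\sum_k mrc_weight q p x (Zc ^~ w) k) / N%:R.
    by congr (_ / _); apply: eq_bigr => k _; rewrite wtE mulr1.
  rewrite -mulr_suml invf_div mulrA divfK ?pnatr_eq0 -?lt0n//.
  by rewrite mulr_suml; apply: eq_bigr => k _; rewrite mulrAC.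
rewrite [X in (_ - X)%E](_ : _ = m%:E)//= -EFinM lee_fin.
apply: ratio_estimate => //; first by rewrite leNgt; exact/negP.
by rewrite leNgt; apply/negP; move: nB1; rewrite /B1/= sqrtr1 mulr1.
Qed.
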